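(* Let $\alpha\in\tilde R$. Then $\alpha\in\tilde R^+$ (resp. $\alpha\in\tilde R^-$) if and only if $\mathrm{ht}(\alpha)>0$ (resp. $\mathrm{ht}(\alpha)<0$).
   Context: Let $A$ be a free abelian group of rank $\nu+1$ with $\mathbb{Z}$-basis $\{\epsilon,\sigma_1,\dots,\sigma_\nu\}$, $\Lambda=\bigoplus_{i=1}^\nu\mathbb{Z}\sigma_i$, and $\tilde R=\{k\epsilon+\sigma: k\in\{0,\pm1\},\ \sigma\in\Lambda\}$ (the toroidal root system of type $A_1$). For $\alpha=k\epsilon+\sigma\in\tilde R$ with $\sigma=\sum_{i=1}^\nu m_i\sigma_i$, put $\mathrm{sgn}(\alpha)=k$, $p(\alpha)=\sigma$, $m^+=\sum_{m_i>0}m_i$, $m^-=\sum_{m_i<0}m_i$ (empty sums are $0$). Height: $\mathrm{ht}_{\mathfrak{B}^0}(\sigma)=2m^+$ if $m^+\ge|m^-|$, and $\mathrm{ht}_{\mathfrak{B}^0}(\sigma)=2m^-$ if $m^+<|m^-|$. Then $\mathrm{ht}(\alpha)=k-\mathrm{ht}_{\mathfrak{B}^0}(\sigma)$ if $k=-1$ and $m^+=|m^-|$, and $\mathrm{ht}(\alpha)=k+\mathrm{ht}_{\mathfrak{B}^0}(\sigma)$ otherwise. Let $(\cdot,\cdot)_E$ be the form on $\Lambda$ given by $(\sum m_i\sigma_i,\sum n_i\sigma_i)_E=\sum_{i=1}^\nu m_in_i$. A nonzero $\alpha\in\tilde R$ is positive if either $\mathrm{sgn}(\alpha)\ne-1$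 and $(p(\alpha),\sum_{i=1}^\nu\sigma_i)_E\ge0$, or $\mathrm{sgn}(\alpha)=-1$ and $(p(\alpha),\sum_{i=1}^\nu\sigma_i)_E>0$. The set of positive elements is $\tilde R^+$; a nonzero $\alpha\in\tilde R$ that is not positive is called negative, and $\tilde R^-$ is the set of negative elements. *)

(* Defs.v *)
From mathcomp Require Import all_boot all_order all_algebra.

Set Implicit Arguments.
Unset Strict Implicit.
Unset Printing Implicit Defensive.

Import Order.TTheory GRing.Theory Num.Theory.
Local Open Scope ring_scope.

(* A Z-basis {eps, sigma_1, ..., sigma_nu} of A; its existence says that A is
   free abelian of rank nu + 1. *)
Record zbasis (nu : nat) (A : zmodType) := ZBasis {
  eps : A;
  sigma : 'I_nu -> A;
  zbasis_span : forall a : A, exists c : int * {ffun 'I_nu -> int},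
    a = eps *~ c.1 + \sum_(i < nu) sigma i *~ c.2 i;
  zbasis_free : forall (k : int) (m : {ffun 'I_nu -> int}),
    eps *~ k + \sum_(i < nu) sigma i *~ m i = 0 ->
    k = 0 /\ (forall i, m i = 0)
}.

Lemma coords_ex (nu : nat) (A : zmodType) (B : zbasis nu A) (a : A) :
  exists c : int * {ffun 'I_nu -> int},
    a == eps B *~ c.1 + \sum_(i < nu) sigma B i *~ c.2 i.
Proof. by have [c /eqP Hc] := zbasis_span B a; exists c. Qed.

(* The coordinates in the basis; they are characterized by [coordsE]. *)
Definition coords (nu : nat) (A : zmodType) (B : zbasis nu A) (a : A) :
  int * {ffun 'I_nu -> int} := xchoose (coords_ex B a).

Lemma coordsE (nu : nat) (A : zmodType) (B : zbasis nu A)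
    (k : int) (m : {ffun 'I_nu -> int}) :
  coords B (eps B *~ k + \sum_(i < nu) sigma B i *~ m i) = (k, m).
Proof.
rewrite /coords; set ex := coords_ex _ _.
case: (xchoose ex) (xchooseP ex) => k' m' /= /eqP/esym/eqP.
rewrite -subr_eq0 opprD addrACA -mulrzBr -sumrB => /eqP.
under eq_bigr => i _ do rewrite -mulrzBr.
move=> H; have [|k0 m0] := @zbasis_free _ _ B (k' - k) [ffun i => m' i - m i].
  by rewrite -[RHS]H; congr (_ + _); apply: eq_bigr => i _; rewrite ffunE.
congr (_, _); first by apply/eqP; rewrite -subr_eq0 k0.
by apply/ffunP => i; apply/eqP; rewrite -subr_eq0; move: (m0 i); rewrite ffunE => ->.
Qed.

Definition sgn (nu : nat) (A : zmodType) (B : zbasis nu A) (a : A) : int :=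
  (coords B a).1.

Definition coef (nu : nat) (A : zmodType) (B : zbasis nu A) (a : A)
  (i : 'I_nu) : int := (coords B a).2 i.

Definition proj (nu : nat) (A : zmodType) (B : zbasis nu A) (a : A) : A :=
  \sum_(i < nu) sigma B i *~ coef B a i.

Definition Lambda (nu : nat) (A : zmodType) (B : zbasis nu A) (s : A) : Prop :=
  exists m : {ffun 'I_nu -> int}, s = \sum_(i < nu) sigma B i *~ m i.

Definition root_system (nu : nat) (A : zmodType) (B : zbasis nu A)
    (alpha : A) : Prop :=
  exists k : int, exists s : A,
    [/\ k \in [:: 0; 1; -1], Lambda B s & alpha = eps B *~ k + s].

Definition mplus (nu : nat) (A : zmodType) (B : zbasis nu A) (s : A) : int :=
  \sum_(i < nu | 0 < coef B s i) coef B s i.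

Definition mminus (nu : nat) (A : zmodType) (B : zbasis nu A) (s : A) : int :=
  \sum_(i < nu | coef B s i < 0) coef B s i.

Definition htB0 (nu : nat) (A : zmodType) (B : zbasis nu A) (s : A) : int :=
  if `|mminus B s| <= mplus B s then 2 * mplus B s else 2 * mminus B s.

Definition ht (nu : nat) (A : zmodType) (B : zbasis nu A) (alpha : A) : int :=
  let k := sgn B alpha in
  let s := proj B alpha in
  if (k == -1) && (mplus B s == `|mminus B s|) then k - htB0 B s
  else k + htB0 B s.

(* Meant for elements of Lambda; the coordinate along eps is ignored. *)
Definition formE (nu : nat) (A : zmodType) (B : zbasis nu A) (s t : A) : int :=
  \sum_(i < nu) coef B s i * coef B t i.

Definition sigma_sum (nu : nat) (A : zmodType) (B : zbasis nu A) : A :=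
  \sum_(i < nu) sigma B i.

Definition positive (nu : nat) (A : zmodType) (B : zbasis nu A)
    (alpha : A) : Prop :=
  [/\ root_system B alpha, alpha != 0 &
      (sgn B alpha <> -1 /\ 0 <= formE B (proj B alpha) (sigma_sum B)) \/
      (sgn B alpha = -1 /\ 0 < formE B (proj B alpha) (sigma_sum B))].

Definition negative (nu : nat) (A : zmodType) (B : zbasis nu A)
    (alpha : A) : Prop :=
  [/\ root_system B alpha, alpha != 0 & ~ positive B alpha].

(* Main.v *)
Require Import Defs.
From mathcomp Require Import all_boot all_order all_algebra.
From mathcomp Require Import zify.

Import Order.TTheory GRing.Theory Num.Theory.
Local Open Scope ring_scope.

(** Write [k], [p] and [n] for the coordinate of [alpha] along [eps] and for
    the sums of its positive and negative coordinates along the [sigma i], so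
    that [0 <= p] and [n <= 0].  Positivity and height depend on the triple
    [(k, p, n)] only:
    - pairing with the sum of the [sigma i] gives [p + n]
      ([formE_sigma_sum]), so the sign of the form is decided by the comparison
      of [p] with [`|n|] that also selects the branch of the height;
    - [alpha = 0] exactly when [k = p = n = 0] ([eq0_signed_sums]).

    The part of the height coming from [Lambda] is even, and it is at least [2]
    in absolute value when it is nonzero, so it dominates [k], which is
    [-1], [0] or [1].  Its sign is that of the form unless [p = `|n|]: in that
    case [k = -1] is the exceptional branch, which gives [-1 - 2 p < 0] for a
    negative root, while [k = 0, 1] gives [k + 2 p], which vanishes only at
    [alpha = 0].  What remains after the reduction to triples is linear integer
    arithmetic. *)

Lemma coef_lincomb {nu : nat} {A : zmodType} (B : zbasis nu A)
    (m : {ffun 'I_nu -> int}) (i : 'I_nu) :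
  coef B (\sum_(j < nu) sigma B j *~ m j) i = m i.
Proof.
by have := coordsE B 0 m; rewrite mulr0z add0r /coef => ->.
Qed.

Lemma coef_proj {nu : nat} {A : zmodType} (B : zbasis nu A) (a : A) :
  coef B (proj B a) =1 coef B a.
Proof. exact: coef_lincomb. Qed.

Lemma coef_sigma_sum {nu : nat} {A : zmodType} (B : zbasis nu A) (i : 'I_nu) :
  coef B (sigma_sum B) i = 1.
Proof.
have := coef_lincomb B [ffun=> 1] i; rewrite ffunE => <-; congr coef.
by apply: eq_bigr => j _; rewrite ffunE mulr1z.
Qed.

Lemma eps_proj_decomp {nu : nat} {A : zmodType} (B : zbasis nu A) (a : A) :
  a = eps B *~ sgn B a + proj B a.
Proof. by apply/eqP; exact: (xchooseP (coords_ex B a)). Qed.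

Lemma sgn_root {nu : nat} {A : zmodType} (B : zbasis nu A) (a : A) :
  root_system B a -> sgn B a \in [:: 0; 1; -1].
Proof. by move=> [k [_ [k_in [m ->] ->]]]; rewrite /sgn coordsE. Qed.

Lemma mplus_ge0 {nu : nat} {A : zmodType} (B : zbasis nu A) (s : A) :
  0 <= mplus B s.
Proof. by apply: sumr_ge0 => i /ltW. Qed.

Lemma mminus_le0 {nu : nat} {A : zmodType} (B : zbasis nu A) (s : A) :
  mminus B s <= 0.
Proof. by apply: sumr_le0 => i /ltW. Qed.

Lemma formE_sigma_sum {nu : nat} {A : zmodType} (B : zbasis nu A) (s : A) :
  formE B s (sigma_sum B) = mplus B s + mminus B s.
Proof.
rewrite /formE /mplus /mminus [X in X + _]big_mkcond [X in _ + X]big_mkcond /=.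
rewrite -big_split; apply: eq_bigr => i _ /=.
by rewrite coef_sigma_sum mulr1; case: ltgtP => [||<-]; rewrite ?addr0 ?add0r.
Qed.

(** Neither sum allows cancellation, so the vanishing of both kills every
    coordinate. *)
Lemma coef_eq0_signed_sums {nu : nat} {A : zmodType} (B : zbasis nu A) (s : A) :
  mplus B s = 0 -> mminus B s = 0 -> forall i, coef B s i = 0.
Proof.
move=> p0 n0 i; case: (ltgtP (coef B s i) 0) => // ci.
- move/eqP: n0; rewrite -oppr_eq0 /mminus -sumrN psumr_eq0; last first.
    by move=> j cj; rewrite oppr_ge0 ltW.
  move/allP/(_ i (mem_index_enum i)); rewrite ci oppr_eq0 => /eqP c0.
  by rewrite c0.
- move/eqP: p0; rewrite /mplus psumr_eq0; last by move=> j /ltW.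
  by move/allP/(_ i (mem_index_enum i)); rewrite ci => /eqP.
Qed.

Lemma eq0_signed_sums {nu : nat} {A : zmodType} (B : zbasis nu A) (a : A) :
  (a == 0) =
  [&& sgn B a == 0, mplus B (proj B a) == 0 & mminus B (proj B a) == 0].
Proof.
apply/eqP/and3P => [a0 | [/eqP k0 /eqP p0 /eqP n0]].
- have [k0 c0] : sgn B a = 0 /\ forall i, coef B a i = 0.
    by apply: (@zbasis_free _ _ B); rewrite -/(proj B a) -eps_proj_decomp.
  rewrite k0 /mplus /mminus.
  by split=> //; rewrite big1 // => i _; rewrite coef_proj c0.
- rewrite [a in LHS](eps_proj_decomp B) k0 mulr0z add0r /proj.
  apply: big1 => i _.
  by rewrite -coef_proj (coef_eq0_signed_sums _ _ p0 n0) mulr0z.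
Qed.

Theorem lemma2p3 (nu : nat) (A : zmodType) (B : zbasis nu A) (alpha : A)
    (halpha : root_system B alpha) :
  (positive B alpha <-> 0 < ht B alpha) /\
  (negative B alpha <-> ht B alpha < 0).
Proof.
rewrite /negative /positive /ht /htB0 formE_sigma_sum.
rewrite (eq0_signed_sums B).
have := sgn_root _ _ halpha.
have := mplus_ge0 B (proj B alpha); have := mminus_le0 B (proj B alpha).
move: (sgn B alpha) (mplus B _) (mminus B _) => k p n n_le0 p_ge0.
rewrite (ler0_norm n_le0) !inE => k_in.
split; (split; [move=> [_ nz sign_form] | move=> sign_ht]).
- by case: ifPn => ?; case: ifPn => ?; lia.
- by split=> //; move: sign_ht; case: ifPn => ?; case: ifPn => ?; lia.
- have {}sign_form pos := sign_form (And3 halpha nz pos).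
  by case: ifPn => ?; case: ifPn => ?; lia.
- by split=> // [|[_ nz pos]]; move: sign_ht;
    case: ifPn => ?; case: ifPn => ?; lia.
Qed.
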